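(* Let $\mathfrak g$ be an untwisted affine Kac--Moody Lie algebra and let $\lambda\in\mathcal P^+$ with $\lambda\le2\rho$ in the dominance order. Then $\lambda=\rho+\beta$ for some weight $\beta\in\mathcal P(\rho)$.
   Context: $\mathfrak g$ is the untwisted affine Kac--Moody Lie algebra (conventions of Kac's book) of a finite-dimensional simple complex Lie algebra of rank $l$, with Cartan subalgebra $\mathfrak h$, derivation $d\in\mathfrak h$, $I=\{0,1,\dots,l\}$, simple roots $\alpha_i$, simple coroots $\alpha_i^\vee$. $\mathcal P^+=\{\lambda\in\mathfrak h^*:\langle\lambda,\alpha_i^\vee\rangle\in\mathbb Z_{\ge0}\ \forall i\in I\}$. Fundamental weights: $\langle\Lambda_i,\alpha_j^\vee\rangle=\delta_{ij}$, $\langle\Lambda_i,d\rangle=0$; $\rho=\sum_{i\in I}\Lambda_i$. Dominance order: $\mu\le\lambda$ iff $\lambda-\mu\in\mathcal Q^+=\bigoplus_{i\in I}\mathbb Z_{\ge0}\alpha_i$. For $\lambda\in\mathcal P^+$, $V(\lambda)$ is the irreducible highest weight $\mathfrak g$-module of highest weight $\lambda$, and $\mathcal P(\lambda)$ is the set of weights $\mu$ whose weight space $V(\lambda)_\mu$ is nonzero. *)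

(* Defs.v *)
From HB Require Import structures.
From mathcomp Require Import all_boot all_order all_algebra.
From mathcomp Require Import classical_sets reals.
From mathcomp.real_closed Require Import complex.

Set Implicit Arguments.
Unset Strict Implicit.
Unset Printing Implicit Defensive.

Import Order.TTheory GRing.Theory Num.Theory.

Local Open Scope classical_set_scope.
Local Open Scope ring_scope.

(** * Cartan matrices of finite and untwisted affine type

    Convention (Kac): [A i j] is the pairing of the simple root [alpha_j] with
    the simple coroot [alpha_i^vee]. *)

Definition gen_cartan_matrix n (A : 'M[int]_n) : Prop :=
  [/\ forall i, A i i = 2,
      forall i j, i != j -> A i j <= 0
    & forall i j, A i j = 0 -> A j i = 0].

Definition indecomposable n (A : 'M[int]_n) : Prop :=
  forall J : {set 'I_n}, J != finset.set0 -> J != finset.setT ->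
    exists i j, [/\ i \in J, j \notin J & A i j != 0].

Definition positive_definite (R : realFieldType) n (S : 'M[R]_n) : Prop :=
  S^T = S /\ forall x : 'rV[R]_n, x != 0 -> 0 < (x *m S *m x^T) 0 0.

(* The Cartan matrices of the finite-dimensional simple complex Lie algebras of
   rank n. *)
Definition finite_cartan_matrix (R : realFieldType) n (A : 'M[int]_n) : Prop :=
  [/\ gen_cartan_matrix A, indecomposable A
    & exists2 D : 'rV[R]_n, (forall i, 0 < D 0 i)
        & positive_definite (diag_mx D *m map_mx intr A)].

(* [root_coroot A a c]: a is a root and c is its coroot. Here a is written in
   the basis of simple roots and c in the basis of simple coroots, and the
   pairs (a, c) are the orbit of the pairs (alpha_i, alpha_i^vee) under the
   Weyl group. In finite type every root arises in this way. *)
Inductive root_coroot n (A : 'M[int]_n) : 'cV[int]_n -> 'cV[int]_n -> Prop :=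
| root_coroot_simple i : root_coroot A (delta_mx i 0) (delta_mx i 0)
| root_coroot_refl i a c : root_coroot A a c ->
    root_coroot A (a - (A *m a) i 0 *: delta_mx i 0)
                  (c - (A^T *m c) i 0 *: delta_mx i 0).

Definition highest_root n (A : 'M[int]_n) (theta thetav : 'cV[int]_n) : Prop :=
  root_coroot A theta thetav /\
  forall a c, root_coroot A a c -> forall i, a i 0 <= theta i 0.

(* Adjunction of a 0-th row and column, with alpha_0 and alpha_0^vee pairing
   with the other coroots and roots as - theta and - theta^vee do. *)
Definition extended_cartan_matrix l (A0 : 'M[int]_l)
    (theta thetav : 'cV[int]_l) : 'M[int]_l.+1 :=
  block_mx (2%:M : 'M_1) (- (thetav^T *m A0)) (- (A0 *m theta)) A0.

Definition untwisted_affine (R : realFieldType) l (A : 'M[int]_l.+1) : Prop :=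
  exists A0 theta thetav,
    [/\ finite_cartan_matrix R A0, highest_root A0 theta thetav
      & A = extended_cartan_matrix A0 theta thetav].

(** * Lie algebras *)

HB.mixin Record Lmodule_isLieAlgebra (K : fieldType) L of GRing.Lmodule K L := {
  lie : L -> L -> L;
  lie_linearl : forall y, linear (lie^~ y);
  lie_linearr : forall x, linear (lie x);
  liexx : forall x, lie x x = 0;
  lie_jacobi : forall x y z,
    lie x (lie y z) + lie y (lie z x) + lie z (lie x y) = 0
}.

#[short(type="lieAlgType")]
HB.structure Definition LieAlgebra (K : fieldType) :=
  {L of Lmodule_isLieAlgebra K L & GRing.Lmodule K L}.

Definition subspace (K : fieldType) (V : lmodType K) (U : set V) : Prop :=
  U 0 /\ forall (a : K) u v, U u -> U v -> U (a *: u + v).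

Section LieSubsets.
Variables (K : fieldType) (L : lieAlgType K).

Definition lie_subalgebra (U : set L) : Prop :=
  subspace U /\ forall x y, U x -> U y -> U (lie x y).

Definition lie_ideal (U : set L) : Prop :=
  subspace U /\ forall x y, U y -> U (lie x y).

Definition lie_generated (S : set L) : set L :=
  [set x | forall U, lie_subalgebra U -> S `<=` U -> U x].

End LieSubsets.

(** * The Cartan subalgebra of an affine Lie algebra

    The basis of h is alpha_0^vee, ..., alpha_l^vee, d; column vectors are the
    coordinates of elements of h in this basis, row vectors the coordinates of
    elements of h^* in the dual basis Lambda_0, ..., Lambda_l, delta. The
    derivation is normalised by <alpha_i, d> = 1 if i = 0, and 0 otherwise. *)

Section Cartan.
Variables (K : fieldType) (l : nat).

Definition cartan := 'cV[K]_(l.+1 + 1).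
Definition cartan_dual := 'rV[K]_(l.+1 + 1).

Definition pairing (mu : cartan_dual) (h : cartan) : K := (mu *m h) 0 0.

Definition simple_coroot (i : 'I_l.+1) : cartan := col_mx (delta_mx i 0) 0.

Definition derivation : cartan := col_mx 0 1%:M.

Definition simple_root (A : 'M[int]_l.+1) (j : 'I_l.+1) : cartan_dual :=
  row_mx (\row_i (A i j)%:~R) (j == ord0)%:R%:M.

Definition fundamental_weight (i : 'I_l.+1) : cartan_dual :=
  row_mx (delta_mx 0 i) 0.

Definition rho : cartan_dual := \sum_(i < l.+1) fundamental_weight i.

Definition dominant_integral : set cartan_dual :=
  [set lam | forall i, exists k : nat, pairing lam (simple_coroot i) = k%:R].

Definition dominance_le (A : 'M[int]_l.+1) (mu lam : cartan_dual) : Prop :=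
  exists k : 'I_l.+1 -> nat, lam - mu = \sum_i simple_root A i *+ k i.

Lemma pairing_simple_root_coroot A i j :
  pairing (simple_root A j) (simple_coroot i) = (A i j)%:~R.
Proof.
rewrite /pairing mul_row_col mulmx0 addr0 mxE (bigD1 i) //= big1 ?addr0.
  by rewrite !mxE !eqxx mulr1.
by move=> k ki; rewrite !mxE (negbTE ki) mulr0.
Qed.

Lemma pairing_simple_root_derivation A j :
  pairing (simple_root A j) derivation = (j == ord0)%:R.
Proof. by rewrite /pairing mul_row_col mulmx0 add0r mulmx1 mxE mulr1n. Qed.

Lemma pairing_fundamental_weight_coroot i j :
  pairing (fundamental_weight i) (simple_coroot j) = (i == j)%:R.
Proof.
rewrite /pairing mul_row_col mulmx0 addr0 mul_delta_mx_cond.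
by case: (i == j); rewrite ?mulr1n ?mulr0n mxE.
Qed.

Lemma pairing_fundamental_weight_derivation i :
  pairing (fundamental_weight i) derivation = 0.
Proof. by rewrite /pairing mul_row_col mulmx0 mul0mx addr0 mxE. Qed.

End Cartan.

(** * The affine Kac-Moody algebra g(A)

    The quadruple (g, h, e, f) is determined up to isomorphism: its axioms say
    that g is the quotient of the Lie algebra presented by the generators e_i,
    f_i, h and the relations below by its largest ideal that meets h
    trivially. *)

Record kac_moody_algebra (K : fieldType) l (A : 'M[int]_l.+1) := KacMoody {
  km_lie :> lieAlgType K;
  km_h : {linear cartan K l -> km_lie};
  km_e : 'I_l.+1 -> km_lie;
  km_f : 'I_l.+1 -> km_lie;
  km_h_inj : injective km_h;
  km_ef : forall i j,
    lie (km_e i) (km_f j) = if i == j then km_h (simple_coroot K i) else 0;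
  km_hh : forall x y, lie (km_h x) (km_h y) = 0;
  km_he : forall x i,
    lie (km_h x) (km_e i) = pairing (simple_root K A i) x *: km_e i;
  km_hf : forall x i,
    lie (km_h x) (km_f i) = - pairing (simple_root K A i) x *: km_f i;
  km_generated :
    lie_generated (range km_e `|` range km_f `|` range km_h) = setT;
  km_no_ideal : forall U, lie_ideal U ->
    U `&` range km_h = [set 0] -> U = [set 0]
}.

(** * Modules *)

Record lie_module (K : fieldType) (L : lieAlgType K) := LieModule {
  lm_carrier :> lmodType K;
  lm_act : L -> lm_carrier -> lm_carrier;
  lm_act_linearl : forall v, linear (lm_act^~ v);
  lm_act_linearr : forall x, linear (lm_act x);
  lm_act_lie : forall x y v,
    lm_act (lie x y) v = lm_act x (lm_act y v) - lm_act y (lm_act x v)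
}.

Definition submodule (K : fieldType) (L : lieAlgType K) (V : lie_module L)
    (U : set V) : Prop :=
  subspace U /\ forall x v, U v -> U (lm_act x v).

Definition irreducible_module (K : fieldType) (L : lieAlgType K)
    (V : lie_module L) : Prop :=
  [set: V] <> [set 0] /\
  forall U : set V, submodule U -> U = [set 0] \/ U = setT.

Section WeightModules.
Variables (K : fieldType) (l : nat) (A : 'M[int]_l.+1).
Variables (g : kac_moody_algebra K A) (V : lie_module g).

Definition weight_space (mu : cartan_dual K l) : set V :=
  [set v | forall h, lm_act (km_h g h) v = pairing mu h *: v].

Definition weights : set (cartan_dual K l) :=
  [set mu | weight_space mu <> [set 0]].

Definition n_plus : set g := lie_generated (range (@km_e _ _ _ g)).

Definition highest_weight_module (lam : cartan_dual K l) : Prop :=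
  exists v : V,
    [/\ v != 0, weight_space lam v,
        forall x, n_plus x -> lm_act x v = 0
      & forall U : set V, submodule U -> U v -> U = setT].

(* V is the module V(lam), which is unique up to isomorphism. *)
Definition irreducible_highest_weight_module (lam : cartan_dual K l) : Prop :=
  irreducible_module V /\ highest_weight_module lam.

End WeightModules.

(* Main.v *)
Require Import Defs.
From HB Require Import structures.
From mathcomp Require Import all_boot all_order all_algebra.
From mathcomp Require Import classical_sets reals.
From mathcomp.real_closed Require Import complex.
From mathcomp Require Import ring lra zify.
From mathcomp Require boolp.

(** Write [lam = 2 rho - x] with [x] in the positive root cone, so that
    [beta = lam - rho] is [rho - x]. The convex hull [C] of the points
    [rho - w rho], enlarged by the half-line of positive multiples of the null
    root, is stable under the shifted reflections [x |-> s_i x + alpha_i] and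
    lies in the positive cone, each [rho - w rho] being a sum of distinct
    positive real roots. It contains [x]: subtract from [x] a multiple of the
    null root so that the support [J] becomes proper, then the largest possible
    multiple of [2 rho_J = rho - w_J rho], and rescale; the condition
    [<x, alpha_i^vee> <= 2] survives while the support shrinks.

    If [rho - x], with [x] integral in [C], is not dominant, some [s_i] raises
    it; iterating, one ends at a dominant [rho - y] with [y >= 0], which is a
    weight by the classical argument for dominant elements below the highest
    weight. From there one comes back to [rho - x] along weight strings, and
    these are unbroken because the [e_i] act locally nilpotently. *)

Set Implicit Arguments.
Unset Strict Implicit.
Unset Printing Implicit Defensive.

Import Order.TTheory GRing.Theory Num.Theory.

Local Open Scope ring_scope.

(** * Simple reflections in coordinates *)

(** For [M = A] this is s_i on coordinates in the simple roots, for [M = A^T] on coordinates in the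
    simple coroots. *)
Definition reflect_mx (S : comPzRingType) n (M : 'M[S]_n) (i : 'I_n)
    (x : 'cV[S]_n) : 'cV[S]_n :=
  x - (M *m x) i 0 *: delta_mx i 0.

Lemma mulmx_delta (S : comPzRingType) n (M : 'M[S]_n) i j :
  (M *m delta_mx j (0 : 'I_1)) i 0 = M i j.
Proof. by rewrite -colE mxE. Qed.

Lemma sum_add_delta n (x : 'cV[int]_n) a i :
  \sum_j (x + a *: delta_mx i 0) j 0 = \sum_j x j 0 + a.
Proof.
under eq_bigr do rewrite mxE; rewrite big_split /=; congr (_ + _).
rewrite (bigD1 i) //= big1 ?addr0 => [|j ji]; first by rewrite !mxE !eqxx mulr1.
by rewrite !mxE (negbTE ji) mulr0.
Qed.

Lemma reflect_mxD (S : comPzRingType) n (M : 'M[S]_n) i x y :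
  reflect_mx M i (x + y) = reflect_mx M i x + reflect_mx M i y.
Proof.
rewrite /reflect_mx mulmxDr [(_ + _ : 'cV_ _) _ _]mxE scalerDl.
by rewrite opprD addrACA.
Qed.

Lemma reflect_mxZ (S : comPzRingType) n (M : 'M[S]_n) i a x :
  reflect_mx M i (a *: x) = a *: reflect_mx M i x.
Proof.
by rewrite /reflect_mx -scalemxAr [(_ *: _ : 'cV_ _) _ _]mxE scalerBr scalerA.
Qed.

Lemma reflect_mx_sum (S : comPzRingType) n (M : 'M[S]_n) i s :
  reflect_mx M i (\sum_(z <- s) z) = \sum_(z <- s) reflect_mx M i z.
Proof.
have r0 : reflect_mx M i 0 = 0 by rewrite -(scale0r 0) reflect_mxZ !scale0r.
exact: (big_morph _ (reflect_mxD M i) r0).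
Qed.

(** * Invariant form and real roots of a symmetrizable matrix *)

Section SymmetrizableForm.
Variables (R : realFieldType) (n : nat) (A : 'M[int]_n) (D : 'I_n -> R).

Local Notation AR := (map_mx intr A : 'M[R]_n).
Local Notation toR := (map_mx (intr : int -> R)).
Local Notation e i := (delta_mx i (0 : 'I_1)).

(** The invariant form on the root space, with Gram matrix [D A] and (alpha_i, alpha_i) = 2 D_i. *)
Definition sym_form (x y : 'cV[R]_n) : R :=
  \sum_i D i * x i 0 * (AR *m y) i 0.

Hypothesis A_diag : forall i, A i i = 2.
Hypothesis D_gt0 : forall i, 0 < D i.
Hypothesis A_sym : forall i j, D i * (A i j)%:~R = D j * (A j i)%:~R.

Lemma sym_formDl x y z : sym_form (x + y) z = sym_form x z + sym_form y z.
Proof.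
by rewrite -big_split; apply: eq_bigr => i _; rewrite mxE mulrDr mulrDl.
Qed.

Lemma sym_formZl a x y : sym_form (a *: x) y = a * sym_form x y.
Proof. by rewrite mulr_sumr; apply: eq_bigr => i _; rewrite mxE; ring. Qed.

Lemma sym_formC x y : sym_form x y = sym_form y x.
Proof.
have E u v : sym_form u v =
    \sum_i \sum_j u i 0 * v j 0 * (D i * (A i j)%:~R).
  apply: eq_bigr => i _; rewrite mxE mulr_sumr.
  by apply: eq_bigr => j _; rewrite mxE; ring.
rewrite !E exchange_big; apply: eq_bigr => i _; apply: eq_bigr => j _.
by rewrite A_sym; ring.
Qed.

Lemma sym_formDr x y z : sym_form x (y + z) = sym_form x y + sym_form x z.
Proof. by rewrite sym_formC sym_formDl !(sym_formC x). Qed.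

Lemma sym_formZr a x y : sym_form x (a *: y) = a * sym_form x y.
Proof. by rewrite sym_formC sym_formZl sym_formC. Qed.

Lemma sym_form_deltal i x : sym_form (e i) x = D i * (AR *m x) i 0.
Proof.
rewrite /sym_form (bigD1 i) //= big1 ?addr0 ?mxE ?eqxx ?mulr1 // => j ji.
by rewrite [delta_mx _ _ _ _]mxE (negbTE ji) mulr0 mul0r.
Qed.

Lemma sym_form_deltar i x : sym_form x (e i) = D i * (AR *m x) i 0.
Proof. by rewrite sym_formC sym_form_deltal. Qed.

Lemma sym_form_delta2 i : sym_form (e i) (e i) = 2 * D i.
Proof. by rewrite sym_form_deltal mulmx_delta mxE A_diag; ring. Qed.

Lemma sym_form_reflect i x y :
  sym_form (reflect_mx AR i x) (reflect_mx AR i y) = sym_form x y.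
Proof.
rewrite /reflect_mx -!scaleNr !(sym_formDl, sym_formDr, sym_formZl, sym_formZr).
by rewrite sym_form_delta2 sym_form_deltal sym_form_deltar; ring.
Qed.

Lemma sym_form_reflectC i x y :
  sym_form (reflect_mx AR i x) y = sym_form x (reflect_mx AR i y).
Proof.
rewrite /reflect_mx -!scaleNr !(sym_formDl, sym_formDr, sym_formZl, sym_formZr).
by rewrite sym_form_deltal sym_form_deltar; ring.
Qed.

Lemma toR_mulmx (x : 'cV[int]_n) i : (AR *m toR x) i 0 = ((A *m x) i 0)%:~R.
Proof. by rewrite -map_mxM mxE. Qed.

Lemma toR_delta i : toR (e i) = e i :> 'cV[R]_n.
Proof. by apply/matrixP => k j; rewrite !mxE; case: (_ && _). Qed.

Lemma toR_reflect i x : toR (reflect_mx A i x) = reflect_mx AR i (toR x).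
Proof.
rewrite /reflect_mx map_mxB map_mxZ toR_mulmx toR_delta //.
Qed.

Lemma reflect_mxK i : involutive (reflect_mx A i).
Proof.
move=> x; rewrite /reflect_mx mulmxBr -scalemxAr.
rewrite [((_ - _ : 'cV_ _) i 0)]mxE [((- _ : 'cV_ _) i 0)]mxE.
rewrite [((_ *: _ : 'cV_ _) i 0)]mxE mulmx_delta A_diag.
set a := (A *m x) i 0; rewrite -addrA -opprD -scalerDl.
by rewrite (_ : a + _ = 0) ?scale0r ?subr0 //; ring.
Qed.

(* [x] is a root and [y] its coroot: [y] represents [2 x / (x, x)], and
   [N] is half of the squared length of [x]. *)
Definition root_pair (N : R) (x y : 'cV[int]_n) : Prop :=
  [/\ 0 < N, sym_form (toR x) (toR x) = 2 * N
    & forall i, D i * (x i 0)%:~R = N * (y i 0)%:~R].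

(** An arithmetic substitute for the Weyl orbit of the simple roots: it contains them, is stable
    under reflections, and carries the integral coroot on which the sign argument rests. *)
Definition real_root (x : 'cV[int]_n) : Prop := exists N y, root_pair N x y.

Lemma root_pair_delta i : root_pair (D i) (e i) (e i).
Proof.
split=> [//||j]; first by rewrite toR_delta sym_form_delta2.
by rewrite mxE; case: eqP => [->//|_]; rewrite !mulr0.
Qed.

(** Both sides compute (alpha_i, x), once through alpha_i^vee and once through the coroot of [x]. *)
Lemma root_pair_mul N x y : root_pair N x y ->
  forall i, D i * ((A *m x) i 0)%:~R = N * ((A^T *m y) i 0)%:~R.
Proof.
move=> [_ _ yP] i; rewrite !mxE !rmorph_sum !mulr_sumr; apply: eq_bigr => j _.
by rewrite [A^T i j]mxE !rmorphM /= mulrA A_sym mulrAC yP; ring.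
Qed.

Lemma root_pair_reflect N x y i : root_pair N x y ->
  root_pair N (reflect_mx A i x) (reflect_mx A^T i y).
Proof.
move=> xy; have [N0 xx yP] := xy; split=> // [|j].
  by rewrite toR_reflect sym_form_reflect.
have /= := root_pair_mul xy i.
rewrite !mxE; case: eqP => [->|_] /= H; last first.
  by rewrite !mulr0 !subr0 yP.
by rewrite !mulr1 !rmorphB !mulrBr yP H.
Qed.

End SymmetrizableForm.

Lemma lt_abszS (a : int) : a < (absz a).+1%:Z.
Proof. lia. Qed.

(* The points [rho - w rho], [w] in the Weyl group, in the basis of simple
   roots. *)
Inductive dot_orbit n (A : 'M[int]_n) : 'cV[int]_n -> Prop :=
| dot_orbit0 : dot_orbit A 0
| dot_orbit_reflect i x : dot_orbit A x ->
    dot_orbit A (reflect_mx A i x + delta_mx i 0).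

(** Generated step by step instead of by finite convex combinations, so that positivity and
    stability under shifted reflections follow by induction. *)
Inductive dot_hull (R : realFieldType) n (A : 'M[int]_n) (delta : 'cV[R]_n) :
    'cV[R]_n -> Prop :=
| dot_hull_orbit x : dot_orbit A x -> dot_hull A delta (map_mx intr x)
| dot_hull_convex t x y : 0 <= t -> t <= 1 ->
    dot_hull A delta x -> dot_hull A delta y ->
    dot_hull A delta (t *: x + (1 - t) *: y)
| dot_hull_delta c x : 0 <= c -> dot_hull A delta x ->
    dot_hull A delta (x + c *: delta).

Lemma int_unit_ge0 (a b : int) : a * b = 1 -> 0 <= a -> a = 1.
Proof. by move=> ab a0; have [b0|b0] := lerP b 0; nia. Qed.

(** * Signs of real roots in affine type *)

Section AffineForm.
Variables (R : archiRealFieldType) (n : nat) (A : 'M[int]_n) (D : 'I_n -> R).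
Variable delta : 'cV[R]_n.

Local Notation AR := (map_mx intr A : 'M[R]_n).
Local Notation toR := (map_mx (intr : int -> R)).
Local Notation e i := (delta_mx i (0 : 'I_1)).
Local Notation form := (sym_form A D).

Hypothesis A_diag : forall i, A i i = 2.
Hypothesis A_off : forall i j, i != j -> A i j <= 0.
Hypothesis D_gt0 : forall i, 0 < D i.
Hypothesis A_sym : forall i j, D i * (A i j)%:~R = D j * (A j i)%:~R.
Hypothesis delta_gt0 : forall i, 0 < delta i 0.
Hypothesis A_delta : AR *m delta = 0.
Hypothesis form_ge0 : forall x, 0 <= form x x.
Hypothesis form_eq0 : forall x, form x x = 0 -> exists c, x = c *: delta.

Lemma form_le0_disjoint (x y : 'cV[R]_n) :
  (forall i, 0 <= x i 0) -> (forall i, 0 <= y i 0) ->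
  (forall i, x i 0 * y i 0 = 0) -> form x y <= 0.
Proof.
move=> x0 y0 xy; apply: sumr_le0 => i _.
rewrite mxE mulr_sumr; apply: sumr_le0 => j _; rewrite mxE.
have [<-|ij] := eqVneq i j.
  rewrite (_ : _ * _ = D i * (A i i)%:~R * (x i 0 * y i 0)); last by ring.
  by rewrite xy mulr0.
have Aij : (A i j)%:~R <= 0 :> R by rewrite lerz0 A_off.
rewrite mulr_ge0_le0 //; first by rewrite mulr_ge0 // ltW.
by rewrite mulr_le0_ge0.
Qed.

(** Isotropic vectors are multiples of [delta], which has no zero coordinate; hence the form is
    definite on each proper support. *)
Lemma form_proper_support (x : 'cV[R]_n) i : x i 0 = 0 -> form x x = 0 -> x = 0.
Proof.
move=> xi /form_eq0[c xE]; move: xi; rewrite xE mxE => /eqP.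
by rewrite mulf_eq0 (gt_eqF (delta_gt0 i)) orbF => /eqP->; rewrite scale0r.
Qed.

(** Adding x_i alpha_i to a partial sum z changes (z, z) by 2 D_i x_i ((A z)_i + x_i), and D_i x_i =
    N y_i with y_i integral. *)
Lemma form_subsum N (x y : 'cV[int]_n) (p : pred 'I_n) :
    root_pair A D N x y -> exists a : int,
  let z := \sum_(i | p i) (x i 0)%:~R *: e i in form z z = 2 * N * a%:~R.
Proof.
move=> [_ _ yP]; elim: (index_enum _) => [|i s [a IH]] /=.
  by exists 0; rewrite big_nil -(scale0r 0) sym_formZl mul0r mulr0.
rewrite big_cons; case: (p i); last by exists a.
set z := \sum_(j <- s | p j) _ in IH *.
have zE : z = toR (\sum_(j <- s | p j) x j 0 *: e j).
  by rewrite raddf_sum; apply: eq_bigr => j _; rewrite /= map_mxZ toR_delta.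
exists (a + y i 0 * ((A *m (\sum_(j <- s | p j) x j 0 *: e j)) i 0 + x i 0)).
rewrite !(sym_formDl, sym_formDr A_sym, sym_formZl, sym_formZr A_sym).
rewrite (sym_form_delta2 D A_diag) (sym_formC A_sym z) sym_form_deltal IH.
rewrite zE toR_mulmx rmorphD rmorphM rmorphD /=.
set X := (x i 0)%:~R; set Y := (y i 0)%:~R; set b := (_ i 0)%:~R.
have H : D i * X = N * Y by apply: yP.
transitivity (2 * (D i * X) * (b + X) + 2 * N * a%:~R); first by ring.
by rewrite H; ring.
Qed.

(* In [x = p + m], with [p] the positive and [m] the negative part, [(p, p)]
   and [(m, m)] are multiples of [(x, x)] and [(p, m) >= 0], so one of [p], [m]
   is isotropic. *)
Lemma real_root_sign (x : 'cV[int]_n) : real_root A D x ->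
  (forall i, 0 <= x i 0) \/ (forall i, x i 0 <= 0).
Proof.
move=> [N [y xy]]; have [N0 xx _] := xy.
have [a] := form_subsum (fun i => 0 < x i 0) xy.
have [b] := form_subsum (fun i => ~~ (0 < x i 0)) xy.
set m := \sum_(i | _) _; set p := \sum_(i | _) _ => /= mm pp.
have coord (P : pred 'I_n) i :
    (\sum_(j | P j) (x j 0)%:~R *: e j : 'cV[R]_n) i 0 =
    if P i then (x i 0)%:~R else 0.
  rewrite summxE; case: ifP => Pi.
    rewrite (bigD1 i) //= big1 ?addr0 ?mxE ?eqxx ?mulr1 // => j /andP[_ ji].
    by rewrite !mxE eq_sym (negbTE ji) mulr0.
  rewrite big1 // => j Pj; rewrite !mxE; case: eqP => [ij|]; rewrite ?mulr0 //.
  by rewrite ij Pj in Pi.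
have pE i : p i 0 = if 0 < x i 0 then (x i 0)%:~R else 0 by rewrite coord.
have mE i : m i 0 = if 0 < x i 0 then 0 else (x i 0)%:~R.
  by rewrite coord; case: (0 < x i 0).
have xE : toR x = p + m.
  apply/matrixP => i j; rewrite ord1 !mxE pE mE.
  by case: ifP; rewrite ?addr0 ?add0r.
have pm : 0 <= form p m.
  rewrite -oppr_le0 -mulN1r -sym_formZr //.
  apply: form_le0_disjoint => i; rewrite ?[(_ *: _ : 'cV_ _) i 0]mxE ?pE ?mE.
  - by case: ifP => // /ltW; rewrite ler0z.
  - by case: ltP; rewrite ?mulr0 // mulN1r oppr_ge0 lerz0.
  - by case: ifP; rewrite ?mulr0 ?mul0r.
have : form (toR x) (toR x) = form p p + form m m + 2 * form p m.
  rewrite xE !(sym_formDl, sym_formDr A_sym) (sym_formC A_sym m p); ring.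
rewrite xx pp mm => xxE.
(* Divide (x, x) = (p, p) + (m, m) + 2 (p, m) by 2 N; the nonnegative integers [a] and [b] cannot
   then both be positive. *)
have ab : a + b <= 1.
  rewrite -(ler_int R) rmorphD /= -(ler_pM2l N0).
  by lra.
have a0 : 0 <= a.
  rewrite -(ler_int R) -(ler_pM2l N0) mulr0.
  by have := form_ge0 p; rewrite pp; lra.
have b0 : 0 <= b.
  rewrite -(ler_int R) -(ler_pM2l N0) mulr0.
  by have := form_ge0 m; rewrite mm; lra.
have /orP[/eqP a00|/eqP b00] : (a == 0) || (b == 0) by lia.
(* Unless all coordinates of [x] are positive, the isotropic [p] has a zero coordinate and so
   vanishes; the case of [m] is similar. *)
- have [/forallP xgt|/forallPn[i /negbTE xi]] := boolP [forall i, 0 < x i 0].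
    by left=> i; exact: ltW.
  right=> j; rewrite leNgt; apply/negP => xj.
  have p0 : p = 0.
    by apply: (form_proper_support (i := i)); rewrite ?pE ?xi // pp a00 mulr0.
  have := pE j; rewrite xj p0 mxE.
  by move/eqP; rewrite eq_sym intr_eq0 (gt_eqF xj).
- have [/existsP[i xi]|/existsPn xle] := boolP [exists i, 0 < x i 0]; last first.
    by right=> i; rewrite leNgt xle.
  left=> j; rewrite leNgt; apply/negP => xj.
  have m0 : m = 0.
    by apply: (form_proper_support (i := i)); rewrite ?mE ?xi // mm b00 mulr0.
  have := mE j; rewrite m0 mxE.
  by rewrite ltNge (ltW xj) => /eqP; rewrite eq_sym intr_eq0 (lt_eqF xj).
Qed.

Definition positive_root (x : 'cV[int]_n) : Prop :=
  real_root A D x /\ forall i, 0 <= x i 0.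

Lemma positive_root_delta i : positive_root (e i).
Proof.
split; first by exists (D i), (e i); apply: root_pair_delta.
by move=> j; rewrite mxE; case: (_ && _).
Qed.

(** Since s_i alters only the i-th coordinate, a change of sign forces x = X alpha_i; the coroot Y
    alpha_i^vee then satisfies X Y = 1 in the integers, so X = 1. *)
Lemma positive_root_reflect i x : positive_root x -> x != e i ->
  positive_root (reflect_mx A i x).
Proof.
move=> [xr x0] xei; have [N [y xy]] := xr.
have sr : real_root A D (reflect_mx A i x).
  by exists N, (reflect_mx A^T i y); apply: root_pair_reflect.
split=> //; have [//|neg] := real_root_sign sr.
have xj j : j != i -> x j 0 = 0.
  move=> ji; apply/eqP; rewrite eq_le x0 andbT.
  by have := neg j; rewrite /reflect_mx !mxE (negbTE ji) mulr0 subr0.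
case/eqP: xei.
have xE : x = x i 0 *: e i.
  apply/matrixP => j k; rewrite ord1 !mxE; case: eqP => [->|/eqP /xj->].
    by rewrite mulr1.
  by rewrite mulr0.
have [N0 xx yP] := xy.
suff x1 : x i 0 = 1 by rewrite xE x1 scale1r.
rewrite xE map_mxZ toR_delta sym_formZl sym_formZr // sym_form_delta2 // in xx.
move: xx (yP i); set X := x i 0; set Y := y i 0 => XX XY.
have D0 := D_gt0 i.
have XY1 : X%:~R * Y%:~R * N = N :> R.
  by transitivity (X%:~R * (N * Y%:~R)); [ring | rewrite -XY; lra].
suff XY1' : X * Y = 1.
  have X0 : 0 <= X by apply: x0.
  exact: int_unit_ge0 XY1' X0.
apply/eqP; rewrite -(eqr_int R) rmorphM /=; apply/eqP.
by apply: (mulIf (lt0r_neq0 N0)); rewrite mul1r.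
Qed.

(** * The Weyl orbit of rho *)

(** The list acts as an inversion set. If alpha_i occurs, its image - alpha_i cancels the shift;
    otherwise the shift adds alpha_i as a new root. Distinctness ensures that a single copy has to
    cancel. *)
Lemma dot_orbit_sum x : dot_orbit A x -> exists s : seq 'cV[int]_n,
  [/\ uniq s, forall z, z \in s -> positive_root z & x = \sum_(z <- s) z].
Proof.
elim=> [|i {}x _ [s [us rs xE]]]; first by exists [::]; rewrite big_nil.
have ri : injective (reflect_mx A i) := inv_inj (reflect_mxK A_diag i).
have rE t : reflect_mx A i (\sum_(z <- t) z) =
    \sum_(z <- [seq reflect_mx A i z | z <- t]) z.
  by rewrite big_map reflect_mx_sum.
have re : reflect_mx A i (e i) = - e i.
  rewrite /reflect_mx mulmx_delta A_diag.
  by apply/matrixP => j k; rewrite !mxE; lia.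
have [es|es] := boolP (e i \in s).
  exists [seq reflect_mx A i z | z <- rem (e i) s]; split.
  - by rewrite map_inj_uniq ?rem_uniq.
  - move=> _ /mapP[z zs ->]; rewrite mem_rem_uniq // inE in zs.
    by case/andP: zs => zi zs; apply: positive_root_reflect => //; apply: rs.
  - rewrite xE (big_rem (e i)) //= reflect_mxD re -rE.
    by rewrite addrC addrA subrr add0r.
exists (e i :: [seq reflect_mx A i z | z <- s]); split.
- rewrite /= map_inj_uniq // us andbT; apply/negP => /mapP[z zs].
  move/(congr1 (reflect_mx A i)); rewrite reflect_mxK // re => zE.
  have [_ /(_ i)] := rs z zs.
  by rewrite -zE !mxE !eqxx.
- move=> z; rewrite inE => /predU1P[->|/mapP[y ys ->]].
    exact: positive_root_delta.
  apply: positive_root_reflect; first exact: rs.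
  by apply: contraNneq es => <-.
- by rewrite big_cons xE rE addrC.
Qed.

Lemma dot_orbit_ge0 x i : dot_orbit A x -> 0 <= x i 0.
Proof.
move=> /dot_orbit_sum[s [_ rs ->]]; rewrite summxE big_seq.
by apply: sumr_ge0 => z /rs[].
Qed.

(* The pairing of [x] with the Weyl vector. *)
Let wt (x : 'cV[R]_n) : R := \sum_i D i * x i 0.

Let wtD x y : wt (x + y) = wt x + wt y.
Proof. by rewrite -big_split; apply: eq_bigr => i _; rewrite mxE mulrDr. Qed.

Let wtZ a x : wt (a *: x) = a * wt x.
Proof. by rewrite mulr_sumr; apply: eq_bigr => i _; rewrite mxE mulrCA. Qed.

Let wt_delta i : wt (e i) = D i.
Proof.
rewrite /wt (bigD1 i) //= big1 ?addr0 ?mxE ?eqxx ?mulr1 // => j ji.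
by rewrite mxE (negbTE ji) mulr0.
Qed.

(** This is |rho - x|^2 = |rho|^2, expanded with (rho, x) = [wt x]. *)
Lemma dot_orbit_form x : dot_orbit A x -> form (toR x) (toR x) = 2 * wt (toR x).
Proof.
elim=> [|i {}x _ IH].
  have -> : toR 0 = 0 *: (0 : 'cV[R]_n) by rewrite scaler0 map_mx0.
  rewrite sym_formZl wtZ.
  by rewrite !(mul0r, mulr0).
rewrite map_mxD toR_reflect toR_delta.
have sqD u v : form (u + v) (u + v) = form u u + 2 * form u v + form v v.
  by rewrite !(sym_formDl, sym_formDr A_sym) (sym_formC A_sym v u); ring.
rewrite sqD sym_form_reflect // IH (sym_form_delta2 D A_diag).
rewrite (sym_formC A_sym _ (e i)) /reflect_mx -!scaleNr !wtD wtZ wt_delta.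
rewrite !(sym_formDr A_sym, sym_formZr A_sym) (sym_form_delta2 D A_diag).
by rewrite sym_form_deltal; ring.
Qed.

(* Every point [rho - x] of the Weyl orbit of [rho] is regular. *)
Lemma dot_orbit_regular x z : dot_orbit A x -> real_root A D z ->
  form (toR z) (toR x) != wt (toR z).
Proof.
move=> ox; elim: ox z => [|i {}x _ IH] z zr.
  (* At x = 0 the claim is (rho, z) <> 0: the coordinates of a real root have one sign and the D_i
     are positive. *)
  rewrite (_ : toR 0 = 0 *: 0) ?sym_formZr ?scale0r ?map_mx0 // mul0r.
  apply/eqP => wt0; have [N [y [N0 zz _]]] := zr.
  suff z0 : toR z = 0.
    by move: zz; rewrite z0 -(scale0r 0) sym_formZl mul0r; lra.
  have Dz j : D j * (toR z) j 0 = 0.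
    have [pos|neg] := real_root_sign zr.
      move/esym/eqP: wt0; rewrite /wt psumr_eq0 => [/allP/(_ j)|k _].
        by rewrite mem_index_enum => /(_ isT)/eqP.
      by rewrite mulr_ge0 ?(ltW (D_gt0 _)) // mxE ler0z.
    move/esym/eqP: wt0; rewrite /wt -oppr_eq0 -sumrN.
    rewrite psumr_eq0 => [/allP/(_ j)|k _].
      by rewrite mem_index_enum => /(_ isT); rewrite oppr_eq0 => /eqP.
    by rewrite -mulrN mulr_ge0 ?(ltW (D_gt0 _)) // mxE oppr_ge0 lerz0.
  apply/matrixP => j k; rewrite ord1 [RHS]mxE; have /eqP := Dz j.
  by rewrite mulf_eq0 (gt_eqF (D_gt0 j)) => /eqP.
have [N [y zy]] := zr.
(* The pairing of z with s_i (rho - x) is that of s_i z with rho - x. *)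
have rz : real_root A D (reflect_mx A i z).
  by exists N, (reflect_mx A^T i y); apply: root_pair_reflect.
have := IH _ rz; rewrite (map_mxD _ (reflect_mx A i x)) !toR_reflect toR_delta.
rewrite (sym_formDr A_sym (toR z)).
rewrite -(sym_form_reflectC A_sym) sym_form_deltar //.
rewrite /reflect_mx -!scaleNr !wtD wtZ wt_delta; apply: contraNneq => H; lra.
Qed.

(** Regularity at alpha_i, as rho - x pairs with alpha_i^vee to 1 - (A x)_i. *)
Lemma dot_orbit_neq1 x i : dot_orbit A x -> (A *m x) i 0 != 1.
Proof.
move=> ox; apply/eqP => x1.
have er : real_root A D (e i) by exists (D i), (e i); apply: root_pair_delta.
have /eqP[] := dot_orbit_regular ox er.
by rewrite toR_delta sym_form_deltal toR_mulmx x1 mulr1 wt_delta.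
Qed.

(** * Proper supports and parabolic maxima *)

(** A minimum principle: the negative part m of y satisfies (m, m) <= - (m, y) <= 0 and vanishes at
    [i0], hence is zero. *)
Lemma form_support_ge0 (y : 'cV[R]_n) i0 : y i0 0 = 0 ->
  (forall i, y i 0 != 0 -> 0 <= (AR *m y) i 0) -> forall i, 0 <= y i 0.
Proof.
move=> y0 Ay; pose m : 'cV[R]_n := \col_i (if y i 0 < 0 then - y i 0 else 0).
have mE i : m i 0 = if y i 0 < 0 then - y i 0 else 0 by rewrite mxE.
have m_ge0 i : 0 <= m i 0 by rewrite mE; case: ifP => // /ltW; rewrite oppr_ge0.
have pm : form m (y + m) <= 0.
  apply: form_le0_disjoint => // i; rewrite [(y + m) i 0]mxE mE.
    by case: ltP; rewrite ?addr0 // subrr.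
  by case: ifP; rewrite ?mul0r // subrr mulr0.
have my : 0 <= form m y.
  apply: sumr_ge0 => i _; rewrite mE.
  case: ifP => yi; last by rewrite mulr0 mul0r.
  by rewrite !mulr_ge0 ?oppr_ge0 ?(ltW yi) ?(ltW (D_gt0 i)) ?Ay ?lt_eqF.
have mm : form m m = 0.
  apply/eqP; rewrite eq_le form_ge0 andbT.
  by move: pm; rewrite sym_formDr //; lra.
have m0 : m = 0.
  by apply: (form_proper_support (i := i0)) => //; rewrite mE y0 ltxx.
move=> i; rewrite leNgt; apply/negP => yi.
by have := mE i; rewrite m0 mxE yi => /eqP; rewrite eq_sym oppr_eq0 (lt_eqF yi).
Qed.

Lemma proper_block_solve (J : {set 'I_n}) i0 : i0 \notin J ->
  exists r : 'cV[R]_n, (forall i, i \notin J -> r i 0 = 0) /\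
    (forall i, i \in J -> (AR *m r) i 0 = 2).
Proof.
move=> i0J.
(* The block of [A] on [J], completed by the identity; a kernel vector would be isotropic with
   support in [J]. *)
pose M : 'M[R]_n := \matrix_(i, j)
  if i \in J then (if j \in J then AR i j else 0) else (i == j)%:R.
have MoutE (v : 'cV[R]_n) i : i \notin J -> (M *m v) i 0 = v i 0.
  move=> iJ; rewrite mxE (bigD1 i) //= big1 ?addr0 => [|j ji].
    by rewrite mxE (negbTE iJ) eqxx mul1r.
  by rewrite mxE (negbTE iJ) eq_sym (negbTE ji) mul0r.
have MinE (v : 'cV[R]_n) i : (forall j, j \notin J -> v j 0 = 0) -> i \in J ->
    (M *m v) i 0 = (AR *m v) i 0.
  move=> v0 iJ; rewrite !mxE; apply: eq_bigr => j _; rewrite [M i j]mxE iJ.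
  by case: ifPn => // /v0->; rewrite !mulr0.
have Munit : M \in unitmx.
  rewrite -unitmx_tr unitmxE unitfE; apply/det0P => -[v v0].
  move=> /(congr1 trmx); rewrite trmx_mul trmxK trmx0 => Mv; case/eqP: v0.
  have vout i : i \notin J -> v^T i 0 = 0 by move=> iJ; rewrite -MoutE // Mv mxE.
  apply: trmx_inj; rewrite trmx0; apply: (form_proper_support (i := i0)).
    exact: vout.
  apply: big1 => i _; case: (boolP (i \in J)) => iJ; last first.
    by rewrite vout // mulr0 mul0r.
  have -> : (AR *m v^T) i 0 = 0 by rewrite -MinE // Mv mxE.
  by rewrite mulr0.
exists (invmx M *m \col_i (if i \in J then 2 else 0)).
have MK b : M *m (invmx M *m b) = b :> 'cV[R]_n by rewrite mulKVmx.
have rout i : i \notin J ->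
    (invmx M *m (\col_i (if i \in J then 2 else 0) : 'cV[R]_n)) i 0 = 0.
  by move=> iJ; rewrite -MoutE // MK mxE (negbTE iJ).
by split=> // i iJ; rewrite -MinE // MK mxE iJ.
Qed.

(* The maximal element is [rho - w_J rho = 2 rho_J], with [w_J] the longest
   element of the parabolic subgroup of [J]. *)
Lemma dot_orbit_parabolic_max (J : {set 'I_n}) i0 : i0 \notin J ->
  exists r, [/\ dot_orbit A r, forall i, i \notin J -> r i 0 = 0
    & forall i, i \in J -> 2 <= (A *m r) i 0].
Proof.
move=> i0J; have [r [rout rin]] := proper_block_solve i0J.
(* For an orbit point x supported in [J], (x, x) = (x, r) = 2 [wt x], so |x - r|^2 >= 0 bounds
   [wt x], and with it the height of x. *)
pose B := (\sum_i (D i)^-1) * form r r.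
have bound x : dot_orbit A x -> (forall i, i \notin J -> x i 0 = 0) ->
    (\sum_i x i 0)%:~R <= B.
  move=> ox xout; have Dx : 2 * wt (toR x) <= form r r.
    have : form (toR x) r = 2 * wt (toR x).
      rewrite /wt mulr_sumr; apply: eq_bigr => i _.
      have [iJ|/xout xi] := boolP (i \in J); first by rewrite rin // mulrC.
      by rewrite mxE xi !(mulr0, mul0r).
    have := form_ge0 (toR x - r); rewrite -scaleN1r.
    rewrite !(sym_formDl, sym_formDr A_sym, sym_formZl, sym_formZr A_sym).
    by rewrite (sym_formC A_sym r) dot_orbit_form //; lra.
  have wx0 i : 0 <= D i * (toR x) i 0.
    by rewrite mulr_ge0 ?(ltW (D_gt0 _)) // mxE ler0z dot_orbit_ge0.
  apply: (@le_trans _ _ ((\sum_i (D i)^-1) * wt (toR x))); last first.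
    apply: ler_wpM2l; first by apply: sumr_ge0 => i _; rewrite invr_ge0 ltW.
    have : 0 <= wt (toR x) by apply: sumr_ge0.
    lra.
  rewrite rmorph_sum mulr_sumr; apply: ler_sum => i _ /=.
  have -> : (x i 0)%:~R = (D i)^-1 * (D i * (toR x) i 0).
    by rewrite mulKf ?gt_eqF // mxE.
  apply: ler_wpM2r => //; rewrite (bigD1 i) //= lerDl.
  by apply: sumr_ge0 => j _; rewrite invr_ge0 ltW.
(* A pairing a < 2 differs from 1, so a <= 0 and the shifted reflection raises the height by 1 - a
   >= 1; the bound [B] stops this. *)
have climb k : (exists r, [/\ dot_orbit A r, forall i, i \notin J -> r i 0 = 0
    & forall i, i \in J -> 2 <= (A *m r) i 0]) \/
  exists x, [/\ dot_orbit A x, forall i, i \notin J -> x i 0 = 0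
    & k%:Z <= \sum_i x i 0].
  elim: k => [|k [?|[x [ox xout xk]]]]; [right|by left|].
    exists 0; split=> [|i _|]; [exact: dot_orbit0 | by rewrite mxE |].
    by apply: sumr_ge0 => i _; rewrite mxE.
  have [/forall_inP xmax|/forall_inPn[i iJ]] :=
    boolP [forall (i | i \in J), 2 <= (A *m x) i 0]; first by left; exists x.
  have := dot_orbit_neq1 i ox; set a := (A *m x) i 0 => a1 a2; right.
  have dotE : reflect_mx A i x + e i = x + (1 - a) *: e i.
    by rewrite /reflect_mx -/a scalerBl scale1r addrAC addrA.
  exists (reflect_mx A i x + e i); split; first exact: dot_orbit_reflect.
    move=> j jJ; rewrite dotE !mxE xout //.
    have /negbTE-> : j != i by apply: contraNneq jJ => ->.
    by rewrite mulr0.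
  by rewrite dotE sum_add_delta; lia.
case: (climb (Num.truncn B).+1) => // -[x [ox xout xk]].
have := bound x ox xout.
have : (Num.truncn B).+1%:R <= (\sum_i x i 0)%:~R :> R.
  by rewrite -(ler_int R) in xk.
have := truncnS_gt B; lra.
Qed.

(** * Points of the shifted hull *)

Lemma mulmx_le0_off (x : 'cV[R]_n) i : (forall j, 0 <= x j 0) -> x i 0 = 0 ->
  (AR *m x) i 0 <= 0.
Proof.
move=> x0 xi; rewrite mxE; apply: sumr_le0 => j _; rewrite mxE.
have [<-|ij] := eqVneq i j; first by rewrite xi mulr0.
by rewrite mulr_le0_ge0 // lerz0 A_off.
Qed.

Lemma dot_hull_ge0 x i : dot_hull A delta x -> 0 <= x i 0.
Proof.
elim=> [{}x ox|t {}x y t0 t1 _ x0 _ y0|c {}x c0 _ x0].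
- by rewrite mxE ler0z dot_orbit_ge0.
- by rewrite !mxE addr_ge0 ?mulr_ge0 ?subr_ge0.
- by rewrite !mxE addr_ge0 ?mulr_ge0 ?(ltW (delta_gt0 _)).
Qed.

Lemma dot_hull_reflect i x : dot_hull A delta x ->
  dot_hull A delta (reflect_mx AR i x + e i).
Proof.
elim=> [{}x ox|t {}x y t0 t1 _ hx _ hy|c {}x c0 _ hx].
- rewrite -toR_reflect -(toR_delta R) -map_mxD.
  by apply: dot_hull_orbit; apply: dot_orbit_reflect.
- have -> : reflect_mx AR i (t *: x + (1 - t) *: y) + e i =
      t *: (reflect_mx AR i x + e i) + (1 - t) *: (reflect_mx AR i y + e i).
    rewrite reflect_mxD !reflect_mxZ.
    move: (reflect_mx AR i x) (reflect_mx AR i y) => u v.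
    by apply/matrixP => j k; rewrite !mxE; ring.
  exact: dot_hull_convex.
- have -> : reflect_mx AR i (x + c *: delta) + e i =
      reflect_mx AR i x + e i + c *: delta.
    rewrite reflect_mxD reflect_mxZ {2}/reflect_mx A_delta mxE scale0r subr0.
    by rewrite addrAC.
  exact: dot_hull_delta.
Qed.

Lemma dot_hull_proper (x : 'cV[R]_n) i0 : x i0 0 = 0 ->
  (forall i, 0 <= x i 0) -> (forall i, (AR *m x) i 0 <= 2) ->
  dot_hull A delta x.
Proof.
have [m] := ubnP #|[set i | x i 0 != 0]|.
elim: m x i0 => // m IH x i0 lt_m xi0 x_ge0 Ax2.
set J := [set i | x i 0 != 0] in lt_m; have JE i : (i \in J) = (x i 0 != 0).
  by rewrite inE.
have [J0|[j0 j0J]] := set_0Vmem J.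
  have -> : x = toR 0.
    apply/matrixP => i j; rewrite ord1 !mxE; apply/eqP.
    by have := JE i; rewrite J0 inE => /esym/negbFE.
  exact/dot_hull_orbit/dot_orbit0.
have i0J : i0 \notin J by rewrite JE xi0 eqxx.
have [r [ro rout rin]] := dot_orbit_parabolic_max i0J.
have r_ge0 i : 0 <= toR r i 0 by rewrite mxE ler0z dot_orbit_ge0.
have Ar2 i : i \in J -> 2 <= (AR *m toR r) i 0.
  by move=> iJ; rewrite toR_mulmx; have := rin i iJ; rewrite -(ler_int R).
have r_gt0 i : i \in J -> 0 < toR r i 0.
  move=> iJ; rewrite lt_neqAle r_ge0 andbT eq_sym; apply: contraTneq isT => ri.
  by have := mulmx_le0_off r_ge0 ri; have := Ar2 i iJ; lra.
have rout' i : i \notin J -> toR r i 0 = 0 by move=> iJ; rewrite mxE rout.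
have xout i : i \notin J -> x i 0 = 0 by rewrite JE negbK => /eqP.
(* The minimum principle applies to r - x, since A x <= 2 <= A r on [J]. It yields t <= 1 for the
   least ratio [t] below. *)
have xr i : x i 0 <= toR r i 0.
  have subE j : (toR r - x) j 0 = toR r j 0 - x j 0 by rewrite !mxE.
  rewrite -subr_ge0 -subE.
  apply: (@form_support_ge0 _ i0); first by rewrite subE rout' // xi0 subrr.
  move=> j; have [jJ _|jJ] := boolP (j \in J); last first.
    by rewrite subE rout' // xout // subrr eqxx.
  rewrite mulmxBr [(_ - _ : 'cV_n) _ _]mxE [(- (_ *m x)) _ _]mxE.
  by have := Ar2 j jJ; have := Ax2 j; lra.
have := @Order.TotalTheory.arg_minP _ _ _ j0 (mem J)
  (fun i => x i 0 / toR r i 0) j0J.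
case=> i1 i1J i1min; set t := x i1 0 / _ in i1min.
have t0 : 0 <= t by rewrite divr_ge0.
have t1 : t <= 1 by rewrite ler_pdivrMr ?r_gt0 // mul1r.
have txr i : t * toR r i 0 <= x i 0.
  have [iJ|iJ] := boolP (i \in J); last by rewrite rout' // mulr0.
  by rewrite -ler_pdivlMr ?r_gt0 // i1min.
have [tE|tn1] := eqVneq t 1.
  have -> : x = toR r.
    apply/matrixP => i j; rewrite ord1; apply/eqP.
    by rewrite eq_le xr; have := txr i; rewrite tE mul1r.
  exact: dot_hull_orbit.
have t1' : 0 < 1 - t by rewrite subr_gt0 lt_neqAle tn1.
(* The rescaled remainder: [x] is a convex combination of [r] and [y], and [y] vanishes also at
   [i1]. *)
pose y := (1 - t)^-1 *: (x - t *: toR r).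
have combE a b (u v : 'cV[R]_n) i :
    (a *: (u - b *: v)) i 0 = a * (u i 0 - b * v i 0).
  by rewrite !mxE.
have yE i : y i 0 = (1 - t)^-1 * (x i 0 - t * toR r i 0) by exact: combE.
have y_ge0 i : 0 <= y i 0 by rewrite yE mulr_ge0 ?invr_ge0 ?(ltW t1') ?subr_ge0.
have yout i : i \notin J -> y i 0 = 0.
  by move=> iJ; rewrite yE xout // rout' // mulr0 subrr mulr0.
have yi1 : y i1 0 = 0.
  by rewrite yE /t divfK ?subrr ?mulr0 // gt_eqF ?r_gt0.
have -> : x = t *: toR r + (1 - t) *: y.
  by rewrite scalerA mulfV ?gt_eqF // scale1r addrC subrK.
apply: dot_hull_convex => //; first exact: dot_hull_orbit.
apply: (IH y i1) => // [|i].
  rewrite ltnS in lt_m; apply: leq_trans lt_m.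
  apply: proper_card; apply/properP; split.
    by apply/fintype.subsetP => i; rewrite inE; apply: contraNT => /yout->.
  by exists i1; [exact: i1J | rewrite inE yi1 eqxx].
(* Off [J] the pairing is at most 0; on [J] it is ((A x)_i - t (A r)_i) / (1 - t) <= (2 - 2 t) / (1
   - t) = 2. *)
have [iJ|/yout yi] := boolP (i \in J); last first.
  by have := mulmx_le0_off y_ge0 yi; lra.
rewrite /y -scalemxAr mulmxBr -scalemxAr combE.
rewrite mulrC ler_pdivrMr //.
by have := Ax2 i; have := Ar2 i iJ; nra.
Qed.

Lemma dot_hull_le2 (i0 : 'I_n) (x : 'cV[R]_n) : (forall i, 0 <= x i 0) ->
  (forall i, (AR *m x) i 0 <= 2) -> dot_hull A delta x.
Proof.
move=> x0 Ax2.
(* The least ratio gives the largest multiple of [delta] below [x]; removing it creates a zero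
   coordinate and leaves [A x] unchanged. *)
have := @Order.TotalTheory.arg_minP _ _ _ i0 predT
  (fun i => x i 0 / delta i 0) isT.
case=> i1 _ i1min; set s := x i1 0 / _ in i1min.
rewrite -[x](subrK (s *: delta)); apply: dot_hull_delta.
  by rewrite divr_ge0 // ltW.
apply: (@dot_hull_proper _ i1) => [|i|i].
- by rewrite !mxE /s divfK ?subrr // gt_eqF.
- by rewrite !mxE subr_ge0 -ler_pdivlMr ?i1min.
- by rewrite mulmxBr -scalemxAr A_delta scaler0 subr0.
Qed.

(** * Sets closed under descending weight strings *)

(* [P k] stands for [rho - sum_i k_i alpha_i] being a weight; the hypothesis
   [P_string] is half of the unbrokenness of weight strings. *)
Section StringClosed.
Variable P : 'cV[int]_n -> Prop.
Hypothesis P0 : P 0.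
Hypothesis P_string : forall (k : 'cV[int]_n) i (p : nat),
  P k -> p%:Z <= 1 - (A *m k) i 0 -> P (k + p%:Z *: e i).

(* If one cannot climb from [k] towards [c], then [c - k] is isotropic, hence
   a multiple of [delta], and [rho - k] would have level zero. *)
Lemma string_closed_dominant (c : 'cV[int]_n) : (forall i, 0 <= c i 0) ->
  (forall i, (A *m c) i 0 <= 1) -> P c.
Proof.
move=> c0 Ac1.
suff climb m : forall k, P k -> (forall i, k i 0 <= c i 0) ->
    \sum_i (c i 0 - k i 0) < m%:Z -> P c.
  apply: (climb (absz (\sum_i c i 0)).+1 0) => // [i|]; first by rewrite mxE.
  by under eq_bigr do rewrite mxE subr0; exact: lt_abszS.
elim: m => [|m IH] k Pk kc ht.
  have : 0 <= \sum_i (c i 0 - k i 0) by apply: sumr_ge0 => i _; rewrite subr_ge0.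
  by rewrite leNgt ht.
have [->//|neq] := eqVneq c k.
have [/existsP[i /andP[ki Aki]]|/existsPn stuck] :=
  boolP [exists i, (k i 0 < c i 0) && ((A *m k) i 0 <= 0)].
  apply: (IH (k + 1%:Z *: e i)) => [|j|].
  - by apply: P_string => //; lia.
  - rewrite !mxE; case: eqP => [->|_] /=; last by rewrite mulr0 addr0.
    by lia.
  - have dec (a b : int) : a - b < m.+1%:Z -> a - (b + 1%:Z) < m%:Z by lia.
    by rewrite sumrB sum_add_delta; apply: dec; rewrite -sumrB.
pose x := toR (c - k).
have xE i : x i 0 = (c i 0 - k i 0)%:~R by rewrite !mxE.
have Ak i : k i 0 < c i 0 -> 1 <= (A *m k) i 0.
  by move=> kci; have := stuck i; rewrite kci -ltNge; lia.
(* Wherever c - k is positive, (A c)_i <= 1 <= (A k)_i. *)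
have xx : form x x = 0.
  apply/eqP; rewrite eq_le form_ge0 andbT; apply: sumr_le0 => i _.
  rewrite xE toR_mulmx mulmxBr.
  have -> : (A *m c - A *m k) i 0 = (A *m c) i 0 - (A *m k) i 0 by rewrite !mxE.
  have [kci|cki] := ltP (k i 0) (c i 0); last first.
    have -> : c i 0 - k i 0 = 0 by have := kc i; lia.
    by rewrite mulr0 mul0r.
  rewrite mulr_ge0_le0 ?mulr_ge0 ?(ltW (D_gt0 i)) ?ler0z ?lerz0 //; first lia.
  by have := Ak i kci; have := Ac1 i; lia.
have [a xa] := form_eq0 xx.
have a0 : a != 0.
  apply: contraNneq neq => a0; apply/eqP/matrixP => i j; rewrite ord1.
  have := xE i; rewrite xa a0 scale0r mxE => /esym/eqP.
  by rewrite intr_eq0 subr_eq0 => /eqP.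
have Ak1 i : 1 <= (A *m k) i 0.
  apply: Ak; rewrite lt_neqAle kc andbT eq_sym -subr_eq0 -(intr_eq0 R) -xE xa mxE.
  by rewrite mulf_neq0 // gt_eqF.
have [i0 _] : exists i0 : 'I_n, true.
  have [i _|none] := pickP (fun i : 'I_n => true); first by exists i.
  by case/eqP: neq; apply/matrixP => i; have := none i.
(* [delta] is orthogonal to everything, whereas its positive coordinates against (A k)_i >= 1 give a
   positive value. *)
have : form delta (toR k) = 0.
  rewrite sym_formC // /sym_form A_delta big1 // => i _.
  by rewrite [X in _ * X]mxE mulr0.
have : 0 < form delta (toR k).
  rewrite /sym_form (bigD1 i0) //= ltr_pwDl //.
    rewrite !mulr_gt0 // toR_mulmx ltr0z; exact: lt_le_trans (Ak1 _).
  apply: sumr_ge0 => i _.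
  rewrite !mulr_ge0 ?(ltW (D_gt0 _)) ?(ltW (delta_gt0 _)) //.
  by rewrite toR_mulmx ler0z; apply: le_trans (Ak1 _).
by move=> /gt_eqF/eqP.
Qed.

(** Induction on the height of k. If a = (A k)_i > 1, the shifted reflection z = k - (a - 1) alpha_i
    stays in the hull and is lower; as 1 - (A z)_i = a - 1, the string from z reaches exactly k. *)
Lemma string_closed_hull (k : 'cV[int]_n) : dot_hull A delta (toR k) -> P k.
Proof.
move=> hk; have k0 i (z : 'cV[int]_n) : dot_hull A delta (toR z) -> 0 <= z i 0.
  by move=> /(dot_hull_ge0 i); rewrite mxE ler0z.
have : \sum_i k i 0 < (absz (\sum_i k i 0)).+1%:Z by exact: lt_abszS.
move: (absz _).+1 => m; elim: m k hk => [|m IH] k hk.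
  have : 0 <= \sum_i k i 0 by apply: sumr_ge0 => i _; apply: k0.
  by move=> h1 /(le_lt_trans h1).
move=> ht.
have [/forallP dom|/forallPn[i ak]] := boolP [forall i, (A *m k) i 0 <= 1].
  by apply: string_closed_dominant => // i; apply: k0.
move: ak; rewrite -ltNge; set a := (A *m k) i 0 => a1.
pose z := reflect_mx A i k + e i.
have zE : z = k - (a - 1) *: e i.
  by rewrite /z /reflect_mx -/a; apply/matrixP => j l; rewrite !mxE; ring.
have -> : k = z + (absz (a - 1))%:Z *: e i.
  by rewrite zE gez0_abs ?subrK //; lia.
apply: P_string; last first.
  have combE b (u v : 'cV[int]_n) : (u - b *: v) i 0 = u i 0 - b * v i 0.
    by rewrite !mxE.
  by rewrite zE mulmxBr -scalemxAr combE -/a mulmx_delta A_diag; lia.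
apply: IH.
  rewrite map_mxD toR_reflect toR_delta; exact: dot_hull_reflect.
by rewrite zE -scaleNr sum_add_delta; lia.
Qed.

Theorem string_closed_le2 (c : 'cV[int]_n) : (forall i, 0 <= c i 0) ->
  (forall i, (A *m c) i 0 <= 2) -> P c.
Proof.
move=> c0 Ac2; apply: string_closed_hull.
have [i0 _|none] := pickP (fun i : 'I_n => true).
  apply: (dot_hull_le2 i0) => i; first by rewrite mxE ler0z.
  by rewrite toR_mulmx; have := Ac2 i; rewrite -(ler_int R).
have -> : c = 0 by apply/matrixP => i; have := none i.
exact/dot_hull_orbit/dot_orbit0.
Qed.

End StringClosed.

End AffineForm.

(** * The form of an extended Cartan matrix *)

Section AffineData.
Variables (R : realFieldType) (l : nat) (A0 : 'M[int]_l).
Variables (theta thetav : 'cV[int]_l) (D0 : 'rV[R]_l) (N : R).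

Local Notation AR := (map_mx intr A0 : 'M[R]_l).
Local Notation toR := (map_mx (intr : int -> R)).
Local Notation form0 := (sym_form A0 (D0 0)).

Hypothesis A0_diag : forall i, A0 i i = 2.
Hypothesis A0_off : forall i j, i != j -> A0 i j <= 0.
Hypothesis D0_gt0 : forall i, 0 < D0 0 i.
Hypothesis A0_sym :
  forall i j, D0 0 i * (A0 i j)%:~R = D0 0 j * (A0 j i)%:~R.
Hypothesis form0_gt0 : forall x, x != 0 -> 0 < form0 x x.
Hypothesis theta_pair : root_pair A0 (D0 0) N theta thetav.
Hypothesis theta_gt0 : forall i, 0 < theta i 0.
Hypothesis theta_dom : forall i, 0 <= (A0 *m theta) i 0.

Let A : 'M[int]_(1 + l) := extended_cartan_matrix A0 theta thetav.

(** The entry at 0 is [N], half the squared length of theta, because alpha_0 = delta - theta. *)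
Definition extended_symmetrizer (i : 'I_(1 + l)) : R := row_mx N%:M D0 0 i.

Definition extended_null_root : 'cV[R]_(1 + l) := col_mx 1%:M (toR theta).

Local Notation D := extended_symmetrizer.
Local Notation delta := extended_null_root.

Let D_l i : D (lshift l i) = N.
Proof. by rewrite /extended_symmetrizer row_mxEl ord1 mxE. Qed.

Let D_r i : D (rshift 1 i) = D0 0 i.
Proof. by rewrite /extended_symmetrizer row_mxEr. Qed.

Let theta_mul i :
  N * ((thetav^T *m A0) 0 i)%:~R = D0 0 i * ((A0 *m theta) i 0)%:~R.
Proof.
rewrite (root_pair_mul A0_sym theta_pair); congr (_ * _%:~R).
by rewrite -[A0^T *m thetav]trmxK trmx_mul trmxK [RHS]mxE.
Qed.

Let theta_form (y : 'cV[R]_l) :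
  N * (toR (thetav^T *m A0) *m y) 0 0 = form0 (toR theta) y.
Proof.
have [_ _ tv] := theta_pair.
rewrite map_mxM -mulmxA mxE mulr_sumr; apply: eq_bigr => i _.
by rewrite mulrA; congr (_ * _); rewrite !mxE -tv.
Qed.

Let mulAR (y0 : 'M[R]_1) (y : 'cV[R]_l) :
  map_mx intr A *m col_mx y0 y =
  col_mx (2 *: y0 - toR (thetav^T *m A0) *m y)
         (AR *m (y - y0 0 0 *: toR theta)).
Proof.
rewrite /A /extended_cartan_matrix map_block_mx mul_block_col; congr col_mx.
  rewrite map_mxN mulNmx; congr (_ - _).
  by apply/matrixP => i j; rewrite !ord1 !mxE big_ord1 !mxE.
rewrite map_mxN map_mxM mulmxBr -scalemxAr addrC; congr (_ + _).
rewrite mulNmx; congr (- _).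
by rewrite {1}[y0]mx11_scalar mul_mx_scalar.
Qed.

(** Modulo the radical, alpha_0 is - theta, so the form is pulled back from the finite root
    space. *)
Lemma extended_formE (x0 y0 : 'M[R]_1) (x y : 'cV[R]_l) :
  sym_form A D (col_mx x0 x) (col_mx y0 y) =
  form0 (x - x0 0 0 *: toR theta) (y - y0 0 0 *: toR theta).
Proof.
have [_ tt _] := theta_pair.
rewrite [LHS]/sym_form mulAR big_split_ord big_ord1 /= !col_mxEu D_l.
rewrite -[ord0]/(0 : 'I_1).
under eq_bigr do rewrite D_r !col_mxEd.
rewrite -[\sum_(i < l) _]/(form0 x _).
rewrite -!scaleNr !(sym_formDl, sym_formDr A0_sym, sym_formZl, sym_formZr A0_sym).
rewrite -theta_form tt [(_ - _ : 'M_1) _ _]mxE [(2 *: _ : 'M_1) _ _]mxE.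
by rewrite [(- _ : 'M_1) _ _]mxE; ring.
Qed.

Lemma extended_affine_data :
  [/\ [/\ forall i, A i i = 2, forall i j, i != j -> A i j <= 0,
      forall i, 0 < D i
      & forall i j, D i * (A i j)%:~R = D j * (A j i)%:~R]
    & [/\ forall i, 0 < delta i 0, map_mx intr A *m delta = 0,
      forall x, 0 <= sym_form A D x x
      & forall x, sym_form A D x x = 0 -> exists c, x = c *: delta]].
Proof.
have [N0 tt _] := theta_pair.
have Alr i j : A (lshift l i) (rshift 1 j) = - (thetav^T *m A0) 0 j.
  by rewrite /A /extended_cartan_matrix block_mxEur ord1 mxE.
have Arl i j : A (rshift 1 i) (lshift l j) = - (A0 *m theta) i 0.
  by rewrite /A /extended_cartan_matrix block_mxEdl ord1 mxE.
have Arr i j : A (rshift 1 i) (rshift 1 j) = A0 i j.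
  by rewrite /A /extended_cartan_matrix block_mxEdr.
have Asym1 i j : N * (A (lshift l i) (rshift 1 j))%:~R =
    D0 0 j * (A (rshift 1 j) (lshift l i))%:~R.
  by rewrite Alr Arl !rmorphN !mulrN /= theta_mul.
have form0_ge0 x : 0 <= form0 x x.
  have [->|/form0_gt0/ltW//] := eqVneq x 0.
  by rewrite -(scale0r 0) sym_formZl mul0r.
split; split.
- move=> i; case: (split_ordP i) => j ->; last by rewrite Arr.
  by rewrite /A /extended_cartan_matrix block_mxEul ord1 mxE.
- move=> i j; case: (split_ordP i) => i' ->; case: (split_ordP j) => j' -> ij.
  + by case/eqP: ij; rewrite !ord1.
  + rewrite Alr oppr_le0 -(ler_int R) -(ler_pM2l N0) mulr0 theta_mul.
    by rewrite mulr_ge0 ?ler0z // ltW.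
  + by rewrite Arl oppr_le0.
  + by rewrite Arr A0_off //; apply: contraNneq ij => ->.
- by move=> i; case: (split_ordP i) => j ->; rewrite ?D_l ?D_r.
- move=> i j; case: (split_ordP i) => i' ->; case: (split_ordP j) => j' ->.
  + by rewrite !ord1.
  + by rewrite D_l D_r.
  + by rewrite D_l D_r Asym1.
  + by rewrite !D_r !Arr.
- move=> i; case: (split_ordP i) => j ->; rewrite ?col_mxEu ?col_mxEd.
    by rewrite ord1 mxE.
  by rewrite mxE ltr0z.
(* The top row amounts to <theta, theta^vee> = 2, read off from (theta, theta) = 2 N after
   multiplying by [N]. *)
- have I00 : (1%:M : 'M[R]_1) 0 0 = 1 by rewrite mxE.
  rewrite mulAR I00 scale1r subrr mulmx0 -[RHS]col_mx0; congr col_mx.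
  apply/matrixP => i j; rewrite !ord1; apply: (mulfI (lt0r_neq0 N0)).
  have -> (u v : 'M[R]_1) : (2 *: u - v) 0 0 = 2 * u 0 0 - v 0 0 by rewrite !mxE.
  by rewrite mulrBr theta_form tt !mxE /=; ring.
- by move=> x; rewrite -[x]vsubmxK extended_formE.
- move=> x; rewrite -[x]vsubmxK extended_formE => fx.
  exists (usubmx x 0 0).
  rewrite scale_col_mx scalemx1; congr col_mx; first exact: mx11_scalar.
  apply/eqP; rewrite -subr_eq0; apply: contraT => /form0_gt0.
  by rewrite fx ltxx.
Qed.

End AffineData.

Lemma root_coroot_pair (R : realFieldType) l (A0 : 'M[int]_l) (D : 'I_l -> R)
    a c :
    (forall i, A0 i i = 2) -> (forall i, 0 < D i) ->
    (forall i j, D i * (A0 i j)%:~R = D j * (A0 j i)%:~R) ->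
  root_coroot A0 a c -> exists N, root_pair A0 D N a c.
Proof.
move=> A_diag D_gt0 A_sym; elim=> [i|i {}a {}c _ [N ac]].
  by exists (D i); apply: root_pair_delta.
by exists N; apply: root_pair_reflect.
Qed.

Lemma untwisted_affine_data (R : realFieldType) l (A : 'M[int]_l.+1) :
  untwisted_affine R A -> exists (D : 'I_l.+1 -> R) (delta : 'cV[R]_l.+1),
  [/\ [/\ forall i, A i i = 2, forall i j, i != j -> A i j <= 0,
      forall i, 0 < D i
      & forall i j, D i * (A i j)%:~R = D j * (A j i)%:~R]
    & [/\ forall i, 0 < delta i 0, map_mx intr A *m delta = 0,
      forall x, 0 <= sym_form A D x x
      & forall x, sym_form A D x x = 0 -> exists c, x = c *: delta]].
Proof.
move=> [A0 [theta [thetav [fin [rt tmax] ->]]]].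
have [[A_diag A_off _] _ [D0 D0_gt0 [S_sym S_pos]]] := fin.
have A_sym i j : D0 0 i * (A0 i j)%:~R = D0 0 j * (A0 j i)%:~R.
  have := congr1 (fun M : 'M[R]_l => M j i) S_sym.
  by rewrite mul_diag_mx !mxE.
have [N tp] := root_coroot_pair A_diag D0_gt0 A_sym rt.
exists (extended_symmetrizer D0 N), (extended_null_root R theta).
apply: extended_affine_data => // [x x0|i|i].
- have xT0 : x^T != 0 by rewrite -trmx0 (inj_eq trmx_inj).
  have := S_pos _ xT0; rewrite trmxK mul_diag_mx -mulmxA mxE.
  congr (0 < _); apply: eq_bigr => i _; rewrite !mxE mulr_sumr mulr_sumr.
  by apply: eq_bigr => j _; rewrite !mxE; ring.
(* Comparison with alpha_i makes the coefficients of theta positive; comparison with s_i theta makes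
   theta dominant. *)
- have := tmax _ _ (root_coroot_simple A0 i) i.
  by rewrite mxE !eqxx; apply: lt_le_trans.
- have := tmax _ _ (root_coroot_refl i rt) i.
  by rewrite [X in X <= _]mxE gerDl !mxE !eqxx mulr1 oppr_le0.
Qed.

Local Open Scope classical_set_scope.
Local Open Scope ring_scope.

(** * Lie algebra actions *)

Section LieModuleTheory.
Variables (K : fieldType) (L : lieAlgType K) (V : lie_module L).

Lemma lm_act0 (x : L) : lm_act x (0 : V) = 0.
Proof. by have := lm_act_linearr x (-1) (0 : V) 0; rewrite !scaleN1r !addNr. Qed.

Lemma lm_actZ (x : L) a (v : V) : lm_act x (a *: v) = a *: lm_act x v.
Proof. by have := lm_act_linearr x a v 0; rewrite lm_act0 !addr0. Qed.

Lemma lm_0act (v : V) : lm_act (0 : L) v = 0.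
Proof. by have := lm_act_linearl v (-1) (0 : L) 0; rewrite !scaleN1r !addNr. Qed.

Lemma lm_actZl a (x : L) (v : V) : lm_act (a *: x) v = a *: lm_act x v.
Proof. by have := lm_act_linearl v a x 0; rewrite lm_0act !addr0. Qed.

Lemma lm_act_comm (x y : L) (v : V) :
  lm_act x (lm_act y v) = lm_act (lie x y) v + lm_act y (lm_act x v).
Proof. by rewrite lm_act_lie subrK. Qed.

End LieModuleTheory.

(** * Weight spaces and sl2 strings *)

Section WeightTheory.
Variables (K : numFieldType) (l : nat) (A : 'M[int]_l.+1).
Variables (g : kac_moody_algebra K A) (V : lie_module g).
Hypothesis A_diag : forall i, A i i = 2.
Implicit Types (mu nu : cartan_dual K l) (u v : V).

Local Notation E i := (lm_act (km_e g i)).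
Local Notation F i := (lm_act (km_f g i)).
Local Notation H h := (lm_act (km_h g h)).
Local Notation wsp := (@weight_space K l A g V).

Lemma pairingD mu nu h : pairing (mu + nu) h = pairing mu h + pairing nu h.
Proof. by rewrite /pairing mulmxDl mxE. Qed.

Lemma pairingN mu h : pairing (- mu) h = - pairing mu h.
Proof. by rewrite /pairing mulNmx mxE. Qed.

Lemma pairingMz mu (n : int) h : pairing (mu *~ n) h = pairing mu h *~ n.
Proof. by rewrite /pairing -scaler_int -scalemxAl mxE mulrzl. Qed.

Lemma pairingMn mu n h : pairing (mu *+ n) h = pairing mu h *+ n.
Proof. exact: (pairingMz mu n). Qed.

Lemma pairing_sum (I : Type) (s : seq I) (f : I -> cartan_dual K l) h :
  pairing (\sum_(i <- s) f i) h = \sum_(i <- s) pairing (f i) h.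
Proof. by rewrite /pairing mulmx_suml summxE. Qed.

Lemma pairing_rho_coroot i : pairing (rho K l) (simple_coroot K i) = 1.
Proof.
rewrite pairing_sum (bigD1 i) //= big1 => [|j ji].
  by rewrite pairing_fundamental_weight_coroot eqxx addr0.
by rewrite pairing_fundamental_weight_coroot (negbTE ji).
Qed.

Lemma nonzero_weight mu v : wsp mu v -> v != 0 -> weights V mu.
Proof. by move=> muv + mu0; rewrite mu0 in muv; rewrite muv eqxx. Qed.

Lemma weightsP mu : weights V mu -> exists2 v, wsp mu v & v != 0.
Proof.
move=> mu0; apply: boolp.contrapT => none; apply: mu0.
rewrite eqEsubset; split=> [v muv|_ -> h]; last by rewrite lm_act0 scaler0.
by apply: boolp.contrapT => /eqP v0; apply: none; exists v.
Qed.

Lemma weight_space_e mu i v : wsp mu v ->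
  wsp (mu + simple_root K A i) (E i v).
Proof.
move=> muv h; rewrite lm_act_comm km_he lm_actZl muv lm_actZ pairingD scalerDl.
by rewrite addrC.
Qed.

Lemma weight_space_f mu i v : wsp mu v ->
  wsp (mu - simple_root K A i) (F i v).
Proof.
move=> muv h; rewrite lm_act_comm km_hf lm_actZl muv lm_actZ pairingD pairingN.
by rewrite scalerDl addrC.
Qed.

Lemma weight_space_iter_e mu i k v : wsp mu v ->
  wsp (mu + simple_root K A i *+ k) (iter k (E i) v).
Proof.
move=> muv; elim: k => [|k IH] /=; first by rewrite addr0.
by rewrite mulrSr addrA; apply: weight_space_e.
Qed.

Lemma weight_space_iter_f mu i k v : wsp mu v ->
  wsp (mu - simple_root K A i *+ k) (iter k (F i) v).
Proof.
move=> muv; elim: k => [|k IH] /=; first by rewrite subr0.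
by rewrite mulrSr opprD addrA; apply: weight_space_f.
Qed.

Lemma sl2_lowering nu i v (m : K) j : wsp nu v -> E i v = 0 ->
    pairing nu (simple_coroot K i) = m ->
  E i (iter j.+1 (F i) v) = (j.+1%:R * (m - j%:R)) *: iter j (F i) v.
Proof.
move=> nuv ev num; elim: j => [|j IH].
  by rewrite /= lm_act_comm km_ef eqxx nuv num ev lm_act0 mul1r subr0 addr0.
rewrite [iter j.+2 _ _]iterS lm_act_comm km_ef eqxx IH lm_actZ -iterS.
rewrite (weight_space_iter_f i j.+1 nuv) -scalerDl; congr (_ *: _).
rewrite pairingD pairingN pairingMn num pairing_simple_root_coroot A_diag.
by rewrite -mulr_natr -(natr1 j.+1) -(natr1 j); ring.
Qed.

(** In characteristic zero (j + 1) (m - j) is nonzero for j < m, so e_i recovers f_i^j v from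
    f_i^(j+1) v. *)
Lemma lowering_neq0 nu i v (m j : nat) : wsp nu v -> v != 0 -> E i v = 0 ->
    pairing nu (simple_coroot K i) = m%:R -> (j <= m)%N ->
  iter j (F i) v != 0.
Proof.
move=> nuv v0 ev num; elim: j => [//|j IH] jm; apply: contraTneq isT => fv0.
have := sl2_lowering j nuv ev num; rewrite fv0 lm_act0 => /esym/eqP.
rewrite scaler_eq0 (negbTE (IH (ltnW jm))) orbF mulf_eq0 pnatr_eq0 /=.
by rewrite -natrB 1?ltnW // pnatr_eq0 subn_eq0 leqNgt jm.
Qed.

(** * Local nilpotency of the e_i in highest weight modules *)

Section HighestWeight.
Variables (lam : cartan_dual K l) (v0 : V).
Hypothesis v0_weight : wsp lam v0.
Hypothesis v0_e : forall i, E i v0 = 0.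
Hypothesis v0_gen : forall U : set V, submodule U -> U v0 -> U = setT.

(** Step n is the span of the vectors obtained from [v0] by at most n operators f_i. *)
Inductive lowering_filtration : nat -> V -> Prop :=
| lowering_top : lowering_filtration 0 v0
| lowering_zero n : lowering_filtration n 0
| lowering_lin n a u v : lowering_filtration n u -> lowering_filtration n v ->
    lowering_filtration n (a *: u + v)
| lowering_f n i u : lowering_filtration n u ->
    lowering_filtration n.+1 (F i u)
| lowering_widen n u : lowering_filtration n u -> lowering_filtration n.+1 u.

Lemma lowering_h n u h : lowering_filtration n u -> lowering_filtration n (H h u).
Proof.
have scale m a w : lowering_filtration m w -> lowering_filtration m (a *: w).
  move=> mw; rewrite -[_ *: _]addr0.
  by apply: lowering_lin => //; apply: lowering_zero.
elim=> [|m|m a {}u v _ IHu _ IHv|m i {}u mu IHu|m {}u _ IHu].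
- by rewrite v0_weight; apply: scale; apply: lowering_top.
- by rewrite lm_act0; apply: lowering_zero.
- by rewrite lm_act_linearr; apply: lowering_lin.
- rewrite lm_act_comm km_hf lm_actZl; apply: lowering_lin; exact: lowering_f.
- exact: lowering_widen.
Qed.

(** Commuting e_i past f_j leaves an element of h or zero, and h preserves each step. *)
Lemma lowering_e n i u : lowering_filtration n u ->
  if n is m.+1 then lowering_filtration m (E i u) else E i u = 0.
Proof.
elim=> [|m|m a {}u v _ IHu _ IHv|m j {}u mu IHu|m {}u mu IHu].
- exact: v0_e.
- by case: m => [|m]; rewrite lm_act0 //; apply: lowering_zero.
- case: m IHu IHv => [|m] IHu IHv; rewrite lm_act_linearr.
    by rewrite IHu IHv scaler0 addr0.
  exact: lowering_lin.
- rewrite lm_act_comm km_ef -[lm_act (if _ then _ else _) _]scale1r.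
  apply: lowering_lin.
    by case: eqP => _; [apply: lowering_h | rewrite lm_0act; apply: lowering_zero].
  case: m mu IHu => [|m] mu IHu.
    by rewrite IHu lm_act0; apply: lowering_zero.
  exact: lowering_f.
- case: m mu IHu => [|m] mu IHu; first by rewrite IHu; apply: lowering_zero.
  exact: lowering_widen.
Qed.

Lemma lowering_leq n m u : (n <= m)%N -> lowering_filtration n u ->
  lowering_filtration m u.
Proof.
move=> /subnK<- nu; elim: (m - n)%N => [//|k IH]; rewrite addSn.
exact: lowering_widen.
Qed.

(** The elements of g preserving the union form a subalgebra containing the generators, so the union
    is a submodule through [v0]. *)
Lemma lowering_exhaustive u : exists n, lowering_filtration n u.
Proof.
pose M := [set w : V | exists n, lowering_filtration n w].
have M_lin a w z : M w -> M z -> M (a *: w + z).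
  move=> [n nw] [m mz]; exists (maxn n m); apply: lowering_lin.
    exact: lowering_leq (leq_maxl _ _) nw.
  exact: lowering_leq (leq_maxr _ _) mz.
have M0 : M 0 by exists 0%N; apply: lowering_zero.
pose U := [set x : g | forall w, M w -> M (lm_act x w)].
have U_alg : lie_subalgebra U.
  split; first split=> [w _|a x y Ux Uy w Mw].
  - by rewrite lm_0act.
  - by rewrite lm_act_linearl; apply: M_lin; [apply: Ux | apply: Uy].
  - move=> x y Ux Uy w Mw; rewrite lm_act_lie addrC -scaleN1r.
    by apply: M_lin; [apply/Uy/Ux | apply/Ux/Uy].
have U_gen : range (km_e g) `|` range (km_f g) `|` range (km_h g) `<=` U.
  move=> _ [[[i _ <-]|[i _ <-]]|[h _ <-]] w [n nw].
  - have := lowering_e i nw; case: n nw => [_ ->|n _ H1]; first exact: M0.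
    by exists n.
  - by exists n.+1; apply: lowering_f.
  - by exists n; apply: lowering_h.
have UT x : U x.
  have : lie_generated (range (km_e g) `|` range (km_f g) `|` range (km_h g)) x.
    by rewrite km_generated.
  exact.
have MT : M = setT.
  apply: v0_gen; last by exists 0%N; apply: lowering_top.
  by split; [split | move=> x w; apply: UT].
by have : M u by rewrite MT.
Qed.

Lemma e_locally_nilpotent i u : exists n, iter n (E i) u = 0.
Proof.
have [n nu] := lowering_exhaustive u; exists n.+1.
elim: n u nu => [|n IH] u /(lowering_e i) //= nu.
by rewrite -iterS iterSr; apply: IH.
Qed.

(* Descend from the last nonzero [e_i^k v], on which [e_i] vanishes. *)
Lemma weight_string mu i (m p : nat) : weights V mu ->
    pairing mu (simple_coroot K i) = m%:R -> (p <= m)%N ->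
  weights V (mu - simple_root K A i *+ p).
Proof.
move=> /weightsP[v muv v_neq0] mum pm.
have ex : exists n, iter n (E i) v == 0.
  by have [n nv] := e_locally_nilpotent i v; exists n; apply/eqP.
case: (ex_minnP ex) => [[|k] /eqP kv kmin]; first by case/eqP: v_neq0.
have kv0 : iter k (E i) v != 0.
  by apply/negP => /kmin; rewrite ltnn.
have muk := weight_space_iter_e i k muv.
have num : pairing (mu + simple_root K A i *+ k) (simple_coroot K i) =
    (m + k.*2)%:R.
  rewrite pairingD pairingMn mum pairing_simple_root_coroot A_diag.
  by rewrite -mulr_natr natrD -muln2 natrM; ring.
(* The first k descents return to [mu], the other p reach the target, and k + p <= m + 2 k. *)
have := weight_space_iter_f i (k + p) muk.
rewrite mulrnDr opprD addrA addrK => /nonzero_weight; apply.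
by apply: (lowering_neq0 muk _ _ num) => //; lia.
Qed.

End HighestWeight.

End WeightTheory.

Theorem proposition5p1 (R : realType) (l : nat) (A : 'M[int]_l.+1)
    (hA : untwisted_affine R A) (g : kac_moody_algebra (complex R) A)
    (Vrho : lie_module g)
    (hV : irreducible_highest_weight_module Vrho (rho (complex R) l))
    (lam : cartan_dual (complex R) l) :
  dominant_integral lam ->
  dominance_le A lam (rho (complex R) l *+ 2) ->
  exists2 beta, weights Vrho beta & lam = rho (complex R) l + beta.
Proof.
move=> dom [k kE].
have [D [delta [[A_diag A_off D_gt0 A_sym] [d_gt0 Ad f_ge0 f_eq0]]]] :=
  untwisted_affine_data hA.
have [_ [v [v_neq0 v_weight v_nplus v_gen]]] := hV.
have v_e i : lm_act (km_e g i) v = 0.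
  by apply: v_nplus => U _; apply; exists i.
pose root_sum (c : 'cV[int]_l.+1) := \sum_i simple_root (complex R) A i *~ c i 0.
have root_sum_coroot c i :
    pairing (root_sum c) (simple_coroot _ i) = ((A *m c) i 0)%:~R.
  rewrite pairing_sum mxE rmorph_sum; apply: eq_bigr => j _.
  by rewrite pairingMz pairing_simple_root_coroot -mulrzl -intrM mulrC.
pose P c := weights Vrho (rho (complex R) l - root_sum c).
have P0 : P 0.
  rewrite /P /root_sum big1 ?subr0 => [|i _]; last by rewrite mxE.
  exact: nonzero_weight v_weight v_neq0.
have P_string (c : 'cV[int]_l.+1) i (p : nat) :
    P c -> p%:Z <= 1 - (A *m c) i 0 -> P (c + p%:Z *: delta_mx i 0).
  move=> Pc pc; rewrite /P.
  have -> : root_sum (c + p%:Z *: delta_mx i 0) =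
      root_sum c + simple_root (complex R) A i *+ p.
    rewrite /root_sum; under eq_bigr do rewrite mxE mulrzDr.
    rewrite big_split /=; congr (_ + _).
    rewrite (bigD1 i) //= big1 ?addr0 => [|j ji].
      by rewrite !mxE !eqxx mulr1.
    by rewrite !mxE (negbTE ji) mulr0.
  rewrite opprD addrA.
  (* The absolute value changes nothing, since 0 <= p <= 1 - (A c)_i. *)
  have rc : pairing (rho (complex R) l - root_sum c) (simple_coroot _ i) =
      (absz (1 - (A *m c) i 0)%R)%:R.
    rewrite pairingD pairingN pairing_rho_coroot root_sum_coroot.
    by rewrite -[RHS]/((absz _)%:Z%:~R) gez0_abs ?rmorphB //; lia.
  refine (weight_string A_diag v_weight v_e v_gen Pc rc _).
  by lia.
(* The coordinates of 2 rho - lam, so that beta = rho - [root_sum c]. *)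
pose c : 'cV[int]_l.+1 := \col_i (k i)%:Z.
have lamE : lam = rho (complex R) l + (rho (complex R) l - root_sum c).
  rewrite addrA -mulr2n -[LHS](subKr (rho (complex R) l *+ 2)) kE; congr (_ - _).
  by apply: eq_bigr => i _; rewrite mxE.
exists (rho (complex R) l - root_sum c) => //.
apply: (string_closed_le2 A_diag A_off D_gt0 A_sym d_gt0 Ad f_ge0 f_eq0
          P0 P_string).
  by move=> i; rewrite mxE.
(* Dominance of [lam] is the bound (A c)_i <= 2, its pairing with alpha_i^vee being 2 - (A c)_i. *)
move=> i; have [m] := dom i.
rewrite lamE !(pairingD, pairingN) pairing_rho_coroot root_sum_coroot => mE.
suff : 2 - (A *m c) i 0 = m%:Z by lia.
apply/eqP; rewrite -(eqr_int (complex R)) -[m%:Z%:~R]/(m%:R) -mE rmorphB /=.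
by apply/eqP; ring.
Qed.
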